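(* Let $G$ be a fixed but arbitrary graph, and let $n$ be a natural number. Let $M$ be the set of all mappings from $G$ to $K_n$ and let $I\subseteq M$ be the set of those mappings which are injective. Then $t(G,K_n)\geq \frac{|I|}{|M|}$.
   Context: All graphs are simple and undirected (no loops, at most one edge between each pair of vertices), finite, and have at least one vertex; natural numbers are positive here. $V(G)$ and $E(G)$ denote the vertex and edge sets of $G$; $K_n$ is the complete graph on $n$ vertices. A mapping $\varphi:G\to F$ between graphs means an arbitrary function $V(G)\to V(F)$, and it is injective if this function is injective. It is a graph homomorphism if $v_1v_2\in E(G)$ implies $\varphi(v_1)\varphi(v_2)\in E(F)$. The homomorphism density is $t(G,F)=\frac{|H|}{|M|}$, where $M$ is the set of all mappings from $G$ to $F$ and $H\subseteq M$ is the set of those that are graph homomorphisms. *)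

(* Defs.v *)
From mathcomp Require Import all_boot all_order all_algebra.

Set Implicit Arguments.
Unset Strict Implicit.
Unset Printing Implicit Defensive.

Import Order.TTheory GRing.Theory Num.Theory.
Local Open Scope ring_scope.

Record graph := Graph {
  vertex :> finType;
  edge : rel vertex;
  edge_sym : symmetric edge;
  edge_irrefl : irreflexive edge;
  vertex_gt0 : (0 < #|vertex|)%N
}.

Section Complete.
Variables (n : nat) (n_gt0 : (0 < n)%N).

Definition complete_edge : rel 'I_n := fun i j => i != j.

Fact complete_edge_sym : symmetric complete_edge.
Proof. by move=> i j; rewrite /complete_edge eq_sym. Qed.

Fact complete_edge_irrefl : irreflexive complete_edge.
Proof. by move=> i; rewrite /complete_edge eqxx. Qed.

Fact complete_vertex_gt0 : (0 < #|'I_n|)%N.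
Proof. by rewrite card_ord. Qed.

Definition complete_graph : graph :=
  Graph complete_edge_sym complete_edge_irrefl complete_vertex_gt0.

End Complete.

Section Mappings.
Variables G F : graph.

Definition is_hom (phi : {ffun G -> F}) : bool :=
  [forall v1, forall v2, edge v1 v2 ==> edge (phi v1) (phi v2)].

Definition mappings : {set {ffun G -> F}} := [set: {ffun G -> F}].
Definition homs : {set {ffun G -> F}} := [set phi in mappings | is_hom phi].
Definition injections : {set {ffun G -> F}} :=
  [set phi in mappings | injectiveb phi].

Definition hom_density : rat := #|homs|%:R / #|mappings|%:R.

End Mappings.

(* Main.v *)
Require Import Defs.
From mathcomp Require Import all_boot all_order all_algebra.

Import GRing.Theory Num.Theory.
Local Open Scope ring_scope.

(** Adjacent vertices of a simple graph are distinct, so an injective mapping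
    sends them to distinct vertices, and distinct vertices of a complete graph
    are adjacent. *)
Lemma injections_sub_homs (G : graph) (n : nat) (n_gt0 : (0 < n)%N) :
  injections G (complete_graph n_gt0) \subset homs G (complete_graph n_gt0).
Proof.
apply/subsetP => phi; rewrite !inE /= => /injectiveP phi_inj.
apply/forallP => u; apply/forallP => v; apply/implyP => uv.
rewrite /= /complete_edge; apply/negP => /eqP /phi_inj eq_uv.
by rewrite eq_uv edge_irrefl in uv.
Qed.

Theorem theorem2p5 (G : graph) (n : nat) (n_gt0 : (0 < n)%N) :
  hom_density G (complete_graph n_gt0) >=
    #|injections G (complete_graph n_gt0)|%:R
      / #|mappings G (complete_graph n_gt0)|%:R.
Proof.
by rewrite ler_wpM2r ?invr_ge0 ?ler0n // ler_nat subset_leq_card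
           ?injections_sub_homs.
Qed.
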